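(* For every integer $r\ge 2$, the generalised H-graph $H^2(r)$ satisfies $\chi_\rho(H^2(r))=7$ if $r\in\{2,4,7,8,11\}$, and $\chi_\rho(H^2(r))=6$ otherwise.
   Context: All graphs are simple; $d_G(u,v)$ is the shortest-path distance. A packing $k$-colouring of $G$ is a map $\pi:V(G)\to\{1,\dots,k\}$ such that for distinct $u,v$, $\pi(u)=\pi(v)=i$ implies $d_G(u,v)>i$; $\chi_\rho(G)$ is the least $k$ for which a packing $k$-colouring exists. For integers $r\ge 2$ and $\ell\ge 1$, the generalised H-graph $H^\ell(r)$ has vertex set $\{u^i_j: 0\le i\le \ell+1,\ 0\le j\le 2r-1\}$ and edge set consisting of: $u^0_ju^0_{j+1}$ and $u^{\ell+1}_ju^{\ell+1}_{j+1}$ for $0\le j\le 2r-1$ (subscripts modulo $2r$); $u^i_{2j}u^i_{2j+1}$ for $1\le i\le \ell$, $0\le j\le r-1$; and $u^i_ju^{i+1}_j$ for $0\le i\le \ell$, $0\le j\le 2r-1$. *)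

(* Defs.v *)
From mathcomp Require Import all_boot.

Set Implicit Arguments.
Unset Strict Implicit.
Unset Printing Implicit Defensive.

Record sgraph := SGraph {
  vertex :> finType;
  edge : rel vertex;
  edge_sym : symmetric edge;
  edge_irrefl : irreflexive edge }.

Section Distance.
Variable G : sgraph.
Implicit Types u v : G.

Definition has_path u v (n : nat) : bool :=
  [exists p : n.-tuple G,
     [&& path (@edge G) u p, uniq (u :: p) & last u p == v]].

Lemma connect_has_path u v :
  connect (@edge G) u v -> exists n, has_path u v n.
Proof.
move=> /connectP[p up ->]; case/shortenP: up => p' up' uniq_p' _.
by exists (size p'); apply/existsP; exists (in_tuple p'); rewrite up' uniq_p' /=.
Qed.

(* [None] is the infinite distance between distinct connected components. *)
Definition dist u v : option nat :=
  if @idP (connect (@edge G) u v) is ReflectT uv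
  then Some (ex_minn (connect_has_path uv)) else None.

Definition dist_gt u v (i : nat) : bool :=
  if dist u v is Some d then i < d else true.

End Distance.

(* Colours are taken in {0, ..., k}, and 0 is then excluded, so that the      *)
(* value of a colour is also the distance it forbids.                         *)
Definition packing_colouring (G : sgraph) (k : nat) (pi : {ffun G -> 'I_k.+1}) :
    bool :=
  [forall v, 0 < pi v] &&
  [forall u, forall v, (u != v) && (pi u == pi v) ==> dist_gt u v (pi u)].

Definition packing_colourable (G : sgraph) (k : nat) : bool :=
  [exists pi : {ffun G -> 'I_k.+1}, packing_colouring pi].

Lemma ex_packing_colourable (G : sgraph) : exists k, packing_colourable G k.
Proof.
exists #|G|; apply/existsP; exists [ffun v => lift ord0 (enum_rank v)].
apply/andP; split; first by apply/forallP=> v; rewrite ffunE.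
apply/forallP=> u; apply/forallP=> v; apply/implyP=> /andP[/negP neq_uv].
by rewrite !ffunE => /eqP/lift_inj/enum_rank_inj eq_uv; case: neq_uv; apply/eqP.
Qed.

Definition chi_rho (G : sgraph) : nat := ex_minn (ex_packing_colourable G).

Section GeneralisedH.
Variables l r : nat.

(* The pair (i, j) stands for the vertex u^i_j.                               *)
Definition gH_vertex : finType := ('I_l.+2 * 'I_(2 * r))%type.

Definition gH_arc (x y : gH_vertex) : bool :=
  [|| [&& x.1 == y.1, (x.1 == 0 :> nat) || (x.1 == l.+1 :> nat)
        & y.2 == x.2.+1 %% (2 * r) :> nat],
      [&& x.1 == y.1, 1 <= x.1 <= l, ~~ odd x.2 & y.2 == x.2.+1 :> nat]
    | (y.1 == x.1.+1 :> nat) && (x.2 == y.2)].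

Definition gH_edge : rel gH_vertex := fun x y => gH_arc x y || gH_arc y x.

Lemma gH_edge_sym : symmetric gH_edge.
Proof. by move=> x y; rewrite /gH_edge orbC. Qed.

Lemma gH_edge_irrefl : irreflexive gH_edge.
Proof.
move=> [i j]; rewrite /gH_edge orbb /gH_arc /= eqxx /=.
rewrite (ltn_eqF (ltnSn i)) (ltn_eqF (ltnSn j)) !andbF !orbF.
suff /negbTE -> : j != j.+1 %% (2 * r) :> nat by rewrite andbF.
have := ltn_ord j; rewrite leq_eqVlt => /predU1P[eq_j | lt_j].
  rewrite eq_j modnn; apply/eqP=> j0.
  by move: eq_j; rewrite j0; case: (r) => [|[]].
by rewrite modn_small // ltn_eqF.
Qed.

End GeneralisedH.

Definition gH (l r : nat) : sgraph :=
  SGraph (@gH_edge_sym l r) (@gH_edge_irrefl l r).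

(* Main.v *)
Require Import Defs.
From mathcomp Require Import all_boot.
From mathcomp Require Import zify.

(** H^2(r) is the quotient of the strip nat x {0,..,3} by a shift of 2r columns,
    and paths lift along the projection, so packing colourings can be studied
    on finite windows of the strip.

    Lower bounds: no six consecutive columns have a packing 5-colouring. For
    six colours, enumerate the packing colourings of six columns, but record
    only where the colours 3, 5 and 6 lie. A 6-colouring of H^2(r) gives a
    closed walk of length r in the graph whose arcs are these 1190 patterns
    (each leading from its first four to its last four columns), and this graph
    has no closed walk of length 4, 7, 8 or 11. The case r = 2 is a direct
    search.

    Upper bounds: two closed walks of lengths 3 and 10 through a common window
    give all r = 10a + 3b; every other r is exceptional or 5, 14, 17. *)

Set Implicit Arguments.
Unset Strict Implicit.
Unset Printing Implicit Defensive.

(** * Distances and the projection of the strip *)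

Section PathDistance.
Variable G : sgraph.
Implicit Types u v : G.

Lemma dist_gt_size u v i (p : seq G) :
  dist_gt u v i -> path (@edge G) u p -> last u p = v -> i < size p.
Proof.
rewrite /dist_gt /dist.
case: {-}_ / (@idP (connect _ u v)) => [uv | not_uv] /=; last first.
  by move=> _ up def_v; case: not_uv; apply/connectP; exists p.
case: ex_minnP => d _ min_d lt_i up def_v; apply: leq_trans lt_i _.
move: def_v; case/shortenP: up => p' up' uniq_p' sub_p' def_v.
apply: leq_trans (min_d (size p') _) _.
  by apply/existsP; exists (in_tuple p'); rewrite /= up' def_v eqxx andbT.
by apply: uniq_leq_size => //; case/andP: uniq_p'.
Qed.

Lemma dist_gtP u v i :
  (forall p, path (@edge G) u p -> last u p = v -> i < size p) -> dist_gt u v i.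
Proof.
move=> far; rewrite /dist_gt /dist; case: {-}_ / (@idP (connect _ u v)) => //= uv.
case: ex_minnP => d /existsP[p /and3P[up _ /eqP def_v]] _.
by rewrite -(size_tuple p) far.
Qed.

(** A walk is never shorter than the distance of its ends, so a condition on all walks replaces the
    one on distances. *)
Lemma packing_colouringP k (pi : {ffun G -> 'I_k.+1}) :
  reflect ((forall v, 0 < pi v) /\
           (forall u p, path (@edge G) u p -> u != last u p ->
              pi u = pi (last u p) -> pi u < size p))
          (packing_colouring pi).
Proof.
apply: (iffP andP) => [[/forallP pos /forallP far]|[pos far]]; split=> //.
  move=> u p up neq_u eq_pi.
  move/forallP/(_ (last u p)): (far u); rewrite neq_u eq_pi eqxx -eq_pi /=.
  by move=> d_gt; apply: dist_gt_size d_gt up _.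
  exact/forallP.
apply/forallP=> u; apply/forallP=> v; apply/implyP=> /andP[neq_uv /eqP eq_pi].
by apply: dist_gtP => p up def_v; rewrite -def_v in neq_uv eq_pi; apply: far.
Qed.

Lemma packing_colourableS k :
  packing_colourable G k -> packing_colourable G k.+1.
Proof.
case/existsP=> pi /packing_colouringP[pos far]; apply/existsP.
exists [ffun v => widen_ord (leqnSn k.+1) (pi v)]; apply/packing_colouringP.
split=> [v | u p up neq_u]; first by rewrite ffunE /=.
by rewrite !ffunE /= => /(congr1 val)/= eq_pi; apply: far => //; apply: val_inj.
Qed.

(** Colourability is monotone in the number of colours, so failure at [k] excludes every smaller
    number. *)
Lemma chi_rho_eq k :
  packing_colourable G k.+1 -> ~~ packing_colourable G k -> chi_rho G = k.+1.
Proof.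
rewrite /chi_rho; case: ex_minnP => m col_m min_m col_k not_k.
apply/eqP; rewrite eqn_leq min_m //= ltnNge; apply: contra not_k => le_mk.
rewrite -(subnK le_mk); elim: (k - m) => // i; rewrite addSn.
exact: packing_colourableS.
Qed.

End PathDistance.

Definition cell := (nat * nat)%type.

(** A cell is (column, row), the reverse of [gH_vertex]. In column [0] the predecessor [j.-1]
    truncates, so later lemmas keep to positive columns. *)
Definition nbrs (x : cell) : seq cell :=
  let: (j, i) := x in
  (if 0 < i then [:: (j, i.-1)] else [::]) ++
  (if i < 3 then [:: (j, i.+1)] else [::]) ++
  if (i == 0) || (i == 3) then [:: (j.-1, i); (j.+1, i)]
  else [:: if odd j then (j.-1, i) else (j.+1, i)].

Fixpoint ball n (x : cell) : seq cell :=
  if n is n'.+1 then undup (x :: flatten [seq nbrs y | y <- ball n' x]) else [:: x].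

Lemma ballS n x y :
  y \in ball n.+1 x = (y == x) || has (fun z => y \in nbrs z) (ball n x).
Proof.
rewrite -[ball n.+1 x]/(undup (x :: flatten [seq nbrs z | z <- ball n x])).
by rewrite mem_undup inE; congr (_ || _); apply/flatten_mapP/hasP.
Qed.

Definition cells j n : seq cell := [seq (j', i) | j' <- iota j n, i <- iota 0 4].

Lemma mem_cells j n (x : cell) :
  (x \in cells j n) = [&& j <= x.1, x.1 < j + n & x.2 < 4].
Proof.
apply/allpairsP/idP => [[[a b] []] | /and3P[le_j lt_j lt_4]].
  by rewrite !mem_iota => a_in b_in ->; rewrite andbA a_in.
by exists x; rewrite !mem_iota le_j lt_j lt_4; case: x {le_j lt_j lt_4}.
Qed.

Local Arguments gH_arc : simpl never.

Section Projection.
Variables (r : nat) (r2_gt0 : 0 < 2 * r).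
Implicit Types (b : nat) (x y z : cell).

(** The offset [b] counts pairs of columns: only even shifts respect the horizontal edges of the two
    inner rows. *)
Definition proj b x : gH 2 r :=
  (inord x.2, Ordinal (ltn_pmod (2 * b + x.1) r2_gt0)).

Lemma odd_proj b j : odd ((2 * b + j) %% (2 * r)) = odd j.
Proof. by rewrite odd_mod ?oddM // oddD oddM. Qed.

Lemma mod_succ n : n.+1 %% (2 * r) = (n %% (2 * r)).+1 %% (2 * r).
Proof. by rewrite -addn1 -modnDml addn1. Qed.

Lemma row_proj b x : x.2 < 4 -> (proj b x).1 = x.2 :> nat.
Proof. exact: inordK. Qed.

Lemma eq_proj b x (v : gH 2 r) : x.2 < 4 -> v.1 = x.2 :> nat ->
  v.2 = (2 * b + x.1) %% (2 * r) :> nat -> proj b x = v.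
Proof.
move=> lt4 eq1 eq2; rewrite [v]surjective_pairing.
by congr pair; apply: val_inj; rewrite //= inordK.
Qed.

Lemma proj_mod b x y m : 2 * r %| m -> x.1 = y.1 %[mod m] -> x.2 = y.2 ->
  proj b x = proj b y.
Proof.
move=> dv_m eq_m eq2; congr pair; first by rewrite eq2.
apply: val_inj => /=; rewrite -(modnDmr _ x.1) -(modnDmr _ y.1).
by rewrite -(modn_dvdm x.1 dv_m) eq_m modn_dvdm.
Qed.

Lemma proj_shift b (j i : nat) : proj b (j.+2, i) = proj b.+1 (j, i).
Proof. by congr pair; apply: val_inj; rewrite /= mulnS -addnA addnCA addnA. Qed.

Lemma proj_shiftr b x : proj (b + r) x = proj b x.
Proof. by congr pair; apply: val_inj; rewrite /= mulnDr addnAC modnDr. Qed.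

Lemma proj_inj b c0 : {in cells c0 (2 * r) &, injective (proj b)}.
Proof.
move=> [j i] [j' i']; rewrite !mem_cells /= => /and3P[le_j lt_j lt_i].
move=> /and3P[le_j' lt_j' lt_i'] [/(congr1 val) eq_i /eqP].
rewrite /= !inordK // in eq_i; rewrite eqn_modDl => eq_j; congr pair => //.
move: eq_j; rewrite -(subnKC le_j) -(subnKC le_j') eqn_modDl.
by rewrite !modn_small ?ltn_subLR // => /eqP->.
Qed.

Lemma gH_arc_succ b (j i : nat) : i < 4 ->
  [|| i == 0, i == 3 | ~~ odd j] -> gH_arc (proj b (j, i)) (proj b (j.+1, i)).
Proof.
move=> lt4; rewrite /gH_arc !row_proj //= eqxx (ltn_eqF (ltnSn i)) orbF /= addnS mod_succ.
rewrite eqxx andbT orbA; case: (boolP ((i == 0) || (i == 3))) => //= inner.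
rewrite odd_proj => even_j; rewrite even_j modn_small ?eqxx //=.
  by move: inner lt4; case: (i) => [|[|[|[|]]]].
(* The last column [2 * r - 1] is odd, so an even column has a successor without wrapping. *)
have := ltn_pmod (2 * b + j) r2_gt0; rewrite leq_eqVlt => /predU1P[|//].
by move/(congr1 odd); rewrite /= odd_proj oddM (negPf even_j).
Qed.

Lemma proj_nbrs b x z : 0 < x.1 -> x.2 < 4 -> z \in nbrs x ->
  [/\ gH_edge (proj b x) (proj b z), z.2 < 4 & x.1 <= z.1.+1].
Proof.
case: x => j i j_gt0 lt4; rewrite /nbrs !mem_cat => /or3P[].
- case: ifP => // i_gt0; rewrite inE => /eqP->.
  have lt4' : i.-1 < 4 by apply: leq_ltn_trans (leq_pred _) lt4.
  split=> //; rewrite /gH_edge /gH_arc !row_proj //=.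
  by rewrite prednK // !eqxx !orbT.
- case: ifP => // i_lt3; rewrite inE => /eqP->.
  by split=> //; rewrite /gH_edge /gH_arc !row_proj //= !eqxx !orbT.
have arc k : [|| i == 0, i == 3 | ~~ odd k] ->
  gH_arc (proj b (k, i)) (proj b (k.+1, i)) by exact: gH_arc_succ.
move: j_gt0 lt4 => /= j_gt0 lt4.
have pred_j : j.-1.+1 = j by apply: prednK.
have := arc j.-1; rewrite pred_j /gH_edge.
have -> : odd j.-1 = ~~ odd j by rewrite -[in RHS]pred_j /= negbK.
case: ifP => [outer arc_pred | _].
  have {}arc_pred : gH_arc (proj b (j.-1, i)) (proj b (j, i)).
    by apply: arc_pred; rewrite orbA outer.
  have arc_j : gH_arc (proj b (j, i)) (proj b (j.+1, i)).
    by apply: arc; rewrite orbA outer.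
  rewrite in_cons mem_seq1 => /orP[]/eqP->.
    by split; rewrite //= ?arc_pred ?orbT ?pred_j.
  by split; rewrite ?arc_j //= leqW.
case: ifP => [odd_j | /negbT even_j] arc_pred; rewrite mem_seq1 => /eqP->.
  by split; rewrite //= ?arc_pred ?orbT ?pred_j.
by split; rewrite ?arc ?even_j ?orbT //= leqW.
Qed.

(** With [proj_nbrs], the covering property of the projection off column [0]: paths lift one edge at
    a time. *)
Lemma lift_edge b x (v : gH 2 r) : 0 < x.1 -> x.2 < 4 -> gH_edge (proj b x) v ->
  exists2 z, z \in nbrs x & proj b z = v.
Proof.
case: x => j i; rewrite [(_, _).1]/= [(_, _).2]/= => j_gt0 lt4.
rewrite /gH_edge /gH_arc row_proj // [(_, _).2]/=.
set n := (2 * b + j) %% (2 * r) => edge_v.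
have n_lt : n < 2 * r by apply: ltn_pmod.
have odd_n : odd n = odd j by apply: odd_proj.
have succ_v (eq_v : v.2 = n.+1 %% (2 * r) :> nat) (eq1 : v.1 = i :> nat) :
    proj b (j.+1, i) = v.
  by apply: eq_proj; rewrite // eq_v -mod_succ addnS.
have pred_v (eq_v : n = v.2.+1 %% (2 * r)) (eq1 : v.1 = i :> nat) :
    proj b (j.-1, i) = v.
  apply: eq_proj => //=; move/eqP: eq_v.
  rewrite /n -(prednK j_gt0) addnS -addn1 -[v.2.+1]addn1 eqn_modDr => /eqP->.
  by rewrite modn_small.
(* Three kinds of arcs leave the projected cell; then the same three enter it. *)
case/orP: edge_v => /or3P[].
- case/and3P=> /eqP eq1 outer /eqP eq2; exists (j.+1, i).
    by rewrite !mem_cat outer !inE eqxx !orbT.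
  by apply: succ_v; rewrite // -eq1 row_proj.
- case/and4P=> /eqP eq1 /andP[i_gt0 i_le2]; rewrite odd_n => even_j /eqP eq2.
  exists (j.+1, i).
    rewrite !mem_cat (negPf even_j).
    by case: ((i == 0) || _); rewrite !inE eqxx !orbT.
  by apply: succ_v; rewrite -?eq1 ?row_proj // -eq2 modn_small.
- case/andP=> /eqP eq1 /eqP eq2; exists (j, i.+1).
    have lt3 : i < 3 by rewrite -ltnS -eq1.
    by rewrite !mem_cat lt3 inE eqxx orbT.
  by apply: eq_proj; rewrite //= -?eq1 -?eq2 ?ltn_ord.
- case/and3P=> /eqP eq1; rewrite eq1 row_proj // => outer /eqP eq2; exists (j.-1, i).
    by rewrite !mem_cat outer !inE eqxx !orbT.
  by apply: pred_v; rewrite ?eq1 ?row_proj.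
- case/and4P=> /eqP eq1 _ even_v /eqP /=; rewrite -/n => eq2; exists (j.-1, i).
    rewrite !mem_cat -odd_n eq2 /= even_v.
    by case: ((i == 0) || _); rewrite !inE eqxx !orbT.
  by apply: pred_v; rewrite ?eq1 ?row_proj // -eq2 modn_small.
case/andP=> /eqP eq1 /eqP eq2; exists (j, i.-1).
  have i_gt0 : 0 < i by rewrite eq1.
  by rewrite !mem_cat i_gt0 inE eqxx.
apply: eq_proj; rewrite //= ?eq1 ?eq2 //; exact: (ltn_ord v.1).
Qed.

(** The column bound carried through the induction keeps every cell whose neighbours are taken off
    column [0]. *)
Lemma ball_path b n x y : n <= x.1 -> x.2 < 4 -> y \in ball n x ->
  [/\ y.2 < 4, x.1 <= y.1 + n & exists2 p, path (@gH_edge 2 r) (proj b x) p &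
      last (proj b x) p = proj b y /\ size p <= n].
Proof.
elim: n y => [|n IHn] y le_n lt4.
  by rewrite inE addn0 => /eqP->; split=> //; exists [::].
rewrite ballS => /predU1P[-> | /hasP[z z_ball y_z]].
  by split=> //; [apply: leq_addr | exists [::]].
have [z4 le_z [p xp [def_z le_p]]] := IHn z (ltnW le_n) lt4 z_ball.
have z_gt0 : 0 < z.1 by rewrite -(ltn_add2r n) add0n (leq_trans le_n).
have [zy y4 le_y] := proj_nbrs b z_gt0 z4 y_z.
split=> //; first by rewrite addnS -addSn (leq_trans le_z) // leq_add2r.
exists (rcons p (proj b y)); rewrite ?rcons_path ?xp ?def_z //=.
by rewrite last_rcons size_rcons.
Qed.

(** The converse inclusion, by lifting the path edge by edge; the upper bounds need it. *)
Lemma path_ball b n x p : n <= x.1 -> x.2 < 4 -> size p <= n ->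
  path (@gH_edge 2 r) (proj b x) p ->
  exists2 y, y \in ball n x & proj b y = last (proj b x) p.
Proof.
move=> + lt4; elim/last_ind: p n => [|p v IHp] [|n] //= le_n le_p.
- by exists x; rewrite ?inE.
- by exists x; rewrite ?ballS ?eqxx.
- by rewrite size_rcons in le_p.
rewrite size_rcons in le_p.
rewrite rcons_path last_rcons => /andP[xp pv].
have [z z_ball def_z] := IHp n (ltnW le_n) le_p xp.
have [z4 le_z _] := ball_path b (ltnW le_n) lt4 z_ball.
have z_gt0 : 0 < z.1 by rewrite -(ltn_add2r n) add0n (leq_trans le_n).
rewrite -def_z in pv; have [y y_z def_v] := lift_edge z_gt0 z4 pv.
by exists y; rewrite // ballS; apply/orP; right; apply/hasP; exists z.
Qed.

End Projection.

(** * Exhaustive search on windows *)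

Definition hits m (B : seq cell) y :=
  has (fun z : cell => (z.1 %% m == y.1 %% m) && (z.2 == y.2)) B.

(* With m = 2r the strip is wound around H^2(r); with m = 0 columns are
   compared as such, since n %% 0 = n. *)
Definition near m c x y := hits m (ball c x) y.

Definition packed m (s : cell -> nat) cs :=
  pairwise (fun x y => near m (s x).+1 x y ==> (s y != s x)) cs.

(* In the search, colours are numbered from 0, and the state holds one bitmask
   per colour, whose bit t forbids that colour on the cell t places ahead. *)
Definition bitmask := seq bool.

Fixpoint mask_or (s t : bitmask) : bitmask :=
  match s, t with
  | [::], _ => t
  | _, [::] => s
  | a :: s', b :: t' => (a || b) :: mask_or s' t'
  end.

Lemma nth_mask_or s t i :
  nth false (mask_or s t) i = nth false s i || nth false t i.
Proof.
by elim: s t i => [|a s IHs] [|b t] [|i] //=; rewrite ?nth_nil ?orbF.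
Qed.

Fixpoint near_masks m k (cs : seq cell) : seq (seq bitmask) :=
  if cs is x :: cs' then
    [seq (let B := ball c.+1 x in [seq hits m B y | y <- cs']) | c <- iota 0 k]
      :: near_masks m k cs'
  else [::].

Definition extend (bs ms : seq bitmask) c : seq (seq bitmask) :=
  let m := nth [::] ms c in
  if head false m then [::]
  else [:: set_nth [::] (map behead ms) c (mask_or (behead m) (nth [::] bs c))].

(** A one-sided invariant: for lower bounds the search must lose no packing colouring, while keeping
    too many would still be sound. *)
Definition respects (s : cell -> nat) cs (ms : seq bitmask) :=
  forall c t, t < size cs -> nth false (nth [::] ms c) t ->
    s (nth (0, 0) cs t) != c.

Lemma respects_nseq s cs k : respects s cs (nseq k [::]).
Proof. by move=> c t _; rewrite nth_nseq if_same nth_nil. Qed.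

Lemma extend_respects m k s x cs ms :
  s x < k -> packed m s (x :: cs) -> size ms = k -> respects s (x :: cs) ms ->
  exists ms', [/\ extend (head [::] (near_masks m k (x :: cs))) ms (s x) = [:: ms'],
                  size ms' = k & respects s cs ms'].
Proof.
move=> lt_k /andP[/allP far _] size_ms resp; rewrite /extend -nth0.
have [/(resp (s x) 0 isT)|_] := boolP (nth false _ 0); first by rewrite eqxx.
eexists; split=> // [|c t lt_t].
  by rewrite size_set_nth size_map size_ms; apply/maxn_idPr.
rewrite nth_set_nth /=; case: eqP => [-> | _].
  rewrite nth_mask_or nth_behead => /orP[/resp|]; first exact.
  rewrite (nth_map 0) ?size_iota // nth_iota // add0n (nth_map (0, 0)) // => near_t.
  exact: (implyP (far _ (mem_nth _ lt_t)) near_t).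
have [lt_c | ge_c] := ltnP c (size ms); last first.
  by rewrite [nth _ (map _ _) c]nth_default ?size_map // nth_nil.
by rewrite (nth_map [::]) // nth_behead => /resp; apply.
Qed.

Fixpoint dead k (tab : seq (seq bitmask)) (ms : seq bitmask) : bool :=
  if tab is bs :: tab' then
    all (fun c => all (dead k tab') (extend bs ms c)) (iota 0 k)
  else false.

(** Following the colours of [s] traces a branch of the search that never gets stuck. *)
Lemma deadPn m k s cs ms : all (fun x => s x < k) cs -> packed m s cs ->
  size ms = k -> respects s cs ms -> ~~ dead k (near_masks m k cs) ms.
Proof.
elim: cs ms => //= x cs IHcs ms /andP[lt_k lts] pack size_ms resp.
have [ms' [def_ms' size_ms' resp']] := extend_respects lt_k pack size_ms resp.
apply/negP=> /allP/(_ (s x)); rewrite mem_iota lt_k => /(_ isT).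
rewrite [extend _ _ _]def_ms' /= andbT; apply/negP; apply: IHcs => //.
by case/andP: pack.
Qed.

(** * Tries of colour patterns and closed walks *)

Inductive trie := Trie of seq trie.

Definition kids t := let: Trie s := t in s.

(** A node without children is a dead prefix; [build] ends accepted words in a node with a dummy
    child, so that it counts as live. *)
Definition live t := if kids t is [::] then false else true.

Definition child t q := nth (Trie [::]) (kids t) q.

Definition sub t (w : seq nat) := foldl child t w.

Lemma live_sub t w : live (sub t w) -> live t.
Proof.
elim: w t => //= q w IHw t /IHw; rewrite /child /live.
by case: (kids t) => //; rewrite nth_nil.
Qed.

(* The accepted words are the images under cls of the colourings found by the
   search; fs collects the search states of all partial colourings with the
   same image, so that every image occurs once. *)
Fixpoint build k a (cls : nat -> nat) (tab fs : seq (seq bitmask)) : trie :=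
  match fs, tab with
  | [::], _ => Trie [::]
  | _, [::] => Trie [:: Trie [::]]
  | _, bs :: tab' =>
    Trie [seq build k a cls tab'
                (flatten [seq flatten [seq extend bs ms c | ms <- fs] |
                           c <- iota 0 k & cls c == q]) | q <- iota 0 a]
  end.

Lemma build_live m k a cls s cs fs ms : (forall c, c < k -> cls c < a) ->
  all (fun x => s x < k) cs -> packed m s cs ->
  ms \in fs -> size ms = k -> respects s cs ms ->
  live (sub (build k a cls (near_masks m k cs) fs) [seq cls (s x) | x <- cs]).
Proof.
move=> cls_lt; elim: cs fs ms => [|x cs IHcs] [|ms0 fs] ms //.
move=> /= /andP[lt_k lts] pack in_fs size_ms resp.
have [ms' [def_ms' size_ms' resp']] := extend_respects lt_k pack size_ms resp.
rewrite /child /= (nth_map 0) ?size_iota ?cls_lt // nth_iota ?cls_lt // add0n.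
apply: (IHcs _ ms') => //; first by case/andP: pack.
apply/flatten_mapP; exists (s x); first by rewrite mem_filter eqxx mem_iota.
apply: (introT (flatten_mapP (s := ms0 :: fs))).
by exists ms; rewrite // [extend _ _ _]def_ms' mem_seq1.
Qed.

Fixpoint words a n t : seq (seq nat) :=
  if live t then
    if n is n'.+1 then
      flatten [seq [seq q :: w | w <- words a n' (child t q)] | q <- iota 0 a]
    else [:: [::]]
  else [::].

Lemma mem_words a t w :
  all (fun q => q < a) w -> live (sub t w) -> w \in words a (size w) t.
Proof.
elim: w t => [|q w IHw] t /=; first by move=> _ ->; rewrite mem_seq1.
case/andP=> lt_q lts live_w; rewrite (@live_sub t (q :: w)) //.
by apply/flatten_mapP; exists q; rewrite ?mem_iota // map_f // IHw.
Qed.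

(** A vertex of the walk is a pair of consecutive blocks of [l] letters; an accepted word
    [u ++ v ++ w] is an arc from [(u, v)] to [(v, w)]. The search is for [n] arcs from [(u, v)] to
    [(u0, v0)]. *)
Fixpoint closes a l T n (u0 v0 u v : seq nat) : bool :=
  if n is n'.+1 then
    has (fun w => closes a l T n' u0 v0 v w) (words a l (sub (sub T u) v))
  else (u == u0) && (v == v0).

Definition has_closed a l T n :=
  has (fun w => let u := take l w in let v := drop l w in closes a l T n u v u v)
      (words a (l + l) T).

Lemma has_closedP a l T n (P : nat -> seq nat) :
  (forall i, size (P i) = l) -> (forall i, all (fun q => q < a) (P i)) ->
  (forall i, live (sub T (P i ++ P i.+1 ++ P i.+2))) ->
  (forall i, P (i + n) = P i) -> has_closed a l T n.
Proof.
move=> sizeP ltP liveP period.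
have closesP i j : closes a l T i (P (j + i)) (P (j + i).+1) (P j) (P j.+1).
  elim: i j => [|i IHi] j /=; first by rewrite addn0 !eqxx.
  apply/hasP; exists (P j.+2); last by rewrite -addSnnS IHi.
  by rewrite -(sizeP j.+2) mem_words // /sub -!foldl_cat liveP.
apply/hasP; exists (P 0 ++ P 1).
  rewrite -{1}(sizeP 0) -(sizeP 1) -size_cat mem_words ?all_cat ?ltP //.
  by apply: (@live_sub _ (P 2)); rewrite /sub -foldl_cat -catA liveP.
rewrite /= take_size_cat // drop_size_cat //.
by have := closesP n 0; rewrite -addSn !period.
Qed.

Lemma cells_uniq j n : uniq (cells j n).
Proof. by apply: allpairs_uniq; rewrite ?iota_uniq // => -[? ?] [? ?]. Qed.

(** * Lower bounds *)

Section LowerBound.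
Variables (r k : nat) (r2_gt0 : 0 < 2 * r) (pi : {ffun gH 2 r -> 'I_k.+1}).
Hypotheses (k_le6 : k <= 6) (pack : packing_colouring pi).

Definition lift_col b x : nat := (pi (proj r2_gt0 b x)).-1.

Lemma lift_colS b x : (lift_col b x).+1 = pi (proj r2_gt0 b x).
Proof. by case/packing_colouringP: pack => pos _; rewrite prednK. Qed.

Lemma lift_col_lt b x : lift_col b x < k.
Proof. by rewrite -ltnS lift_colS. Qed.

(* Windows start at column 6, so that the end of the strip cuts off no ball of
   radius at most 6. *)
Lemma lift_packed m b n : 2 * r %| m -> n <= 2 * r ->
  packed m (lift_col b) (cells 6 n).
Proof.
move=> dv_m le_n; have /packing_colouringP[pos far] := pack.
have := cells_uniq 6 n; rewrite uniq_pairwise.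
apply: (@sub_in_pairwise _ [in cells 6 n]); last exact/allP.
move=> x y x_in y_in /= neq_xy.
apply/implyP=> /hasP[z z_ball /andP[/eqP eq1 /eqP eq2]].
have := x_in; rewrite mem_cells => /and3P[le6 _ lt4].
have le_x : (lift_col b x).+1 <= x.1.
  by rewrite (leq_trans _ le6) // (leq_trans (lift_col_lt _ _)).
have [_ _ [p xp [def_z]]] := ball_path r2_gt0 b le_x lt4 z_ball.
rewrite lift_colS leqNgt; apply: contra => /eqP eq_s; apply: far => //.
  rewrite def_z (proj_mod _ _ dv_m eq1 eq2); apply: contra neq_xy => /eqP.
  have in_cells t : t \in cells 6 n -> t \in cells 6 (2 * r).
    by rewrite !mem_cells => /and3P[-> lt_t ->]; rewrite (leq_trans lt_t) ?leq_add2l.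
  by move/(proj_inj (in_cells _ x_in) (in_cells _ y_in))->.
by apply: val_inj; rewrite /= def_z (proj_mod _ _ dv_m eq1 eq2) -!lift_colS eq_s.
Qed.

Lemma dead_colouring m n : 2 * r %| m -> n <= 2 * r ->
  ~~ dead k (near_masks m k (cells 6 n)) (nseq k [::]).
Proof.
move=> dv_m le_n; apply: deadPn (lift_packed 0 dv_m le_n) _ _.
- by apply/allP=> x _; apply: lift_col_lt.
- by rewrite size_nseq.
exact: respects_nseq.
Qed.

End LowerBound.

Lemma dead5 : dead 5 (near_masks 0 5 (cells 6 6)) (nseq 5 [::]).
Proof. by vm_compute. Qed.

(** Six columns fit without overlap once [3 <= r], and modulus [0] merely drops the constraints from
    wrapping around. *)
Lemma not_colourable5 r : 3 <= r -> ~~ packing_colourable (gH 2 r) 5.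
Proof.
move=> le3r; have r2_gt0 : 0 < 2 * r by rewrite muln_gt0 (leq_trans _ le3r).
apply/negP=> /existsP[pi pack]; have := dead5; apply/negP.
by apply: (dead_colouring r2_gt0 _ pack); rewrite ?dvdn0 // (leq_mul2l 2 3).
Qed.

(** For r = 2 four columns are the whole graph, and modulus [4] winds the balls around it. *)
Lemma dead6_2 : dead 6 (near_masks 4 6 (cells 6 4)) (nseq 6 [::]).
Proof. by vm_compute. Qed.

Lemma not_colourable6_2 : ~~ packing_colourable (gH 2 2) 6.
Proof.
apply/negP=> /existsP[pi pack]; have := dead6_2; apply/negP.
exact: (dead_colouring (isT : 0 < 2 * 2) _ pack).
Qed.

(* Separates the colours 3, 5, 6 from each other and from 1, 2, 4. *)
Definition col_class c := nth 0 [:: 0; 0; 1; 0; 2; 3] c.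

Definition window_trie :=
  build 6 4 col_class (near_masks 0 6 (cells 6 6)) [:: nseq 6 [::]].

Lemma not_closed : ~~ has (has_closed 4 8 window_trie) [:: 4; 7; 8; 11].
Proof. by vm_compute. Qed.

Lemma not_colourable6 r :
  r \in [:: 4; 7; 8; 11] -> ~~ packing_colourable (gH 2 r) 6.
Proof.
move=> r_in; have le3r : 3 <= r by move: r r_in; apply/allP.
have r2_gt0 : 0 < 2 * r by rewrite muln_gt0 (leq_trans _ le3r).
apply/negP=> /existsP[pi pack]; have := not_closed; apply/negP; rewrite negbK.
apply/hasP; exists r => //.
have cls_lt c : c < 6 -> col_class c < 4 by move: c; do 6!case=> //.
(* Raising the offset by one moves two columns along the strip, so three consecutive patterns form
   one window of six columns, and [P] has period [r]. *)
pose P b := [seq col_class (lift_col r2_gt0 pi b x) | x <- cells 6 2].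
have shift b n : [seq col_class (lift_col r2_gt0 pi b x) | x <- cells n.+2 2] =
    [seq col_class (lift_col r2_gt0 pi b.+1 x) | x <- cells n 2].
  by rewrite /= /lift_col !proj_shift.
apply: (@has_closedP _ _ _ _ P) => b.
- by [].
- by apply/allP=> _ /mapP[x _ ->]; apply: cls_lt; apply: lift_col_lt.
- have -> : P b ++ P b.+1 ++ P b.+2 =
      [seq col_class (lift_col r2_gt0 pi b x) | x <- cells 6 6].
    by rewrite /P -(shift b.+1 6) -(shift b 6) -(shift b 8).
  apply: build_live (mem_head _ _) _ _ => //; last exact: respects_nseq.
    by apply/allP=> x _; apply: lift_col_lt.
  by apply: (lift_packed r2_gt0 _ pack); rewrite ?dvdn0 // (leq_mul2l 2 3).
by rewrite /P /= /lift_col !proj_shiftr.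
Qed.

(** * Colourings from cyclic words *)

(* A word lists the blocks of two consecutive columns, top to bottom and left
   to right. *)
Definition look (w : seq (seq nat)) x := nth 0 (nth [::] w x.1./2) (4 * odd x.1 + x.2).

(** Nine blocks leave eight columns on either side of the middle one, room for balls of radius up to
    [8]. *)
Definition window w b : seq (seq nat) :=
  [seq nth [::] w ((b + t) %% size w) | t <- iota 0 9].

(* Checks the two middle columns of a window of eighteen. *)
Definition good k m w :=
  all (fun x => let c := look w x in
    [&& 0 < c, c <= k &
      all (fun y => (y.1 < 18) && ((look w y == c) ==>
                      (y.1 %% m == x.1 %% m) && (y.2 == x.2))) (ball c x)])
      (cells 8 2).

(** Modulus [0] is the strictest test and ignores the length of the cyclic word, so one check serves
    all lengths. *)
Lemma good0 k m w : good k 0 w -> good k m w.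
Proof.
apply: sub_all => x /= /and3P[-> -> /=]; apply: sub_all => y /andP[-> /=].
by case: (look w y == _) => //=; rewrite !modn0 => /andP[/eqP-> ->]; rewrite eqxx.
Qed.

Section UpperBound.
Variables (k : nat) (w : seq (seq nat)).
Hypotheses (r2_gt0 : 0 < 2 * size w) (k_le8 : k <= 8).
Hypothesis good_w : forall b, good k (2 * size w) (window w b).

Lemma proj_surj (u : gH 2 (size w)) :
  exists b, exists2 x, x \in cells 8 2 & proj r2_gt0 b x = u.
Proof.
(* Reading at column [8] adds eight columns; with [4 * (size w).-1] further blocks this makes four
   full turns. *)
exists (u.2./2 + 4 * (size w).-1), (8 + odd u.2, nat_of_ord u.1).
  by rewrite mem_cells; case: (odd _); apply: (ltn_ord u.1).
apply: eq_proj; [exact: (ltn_ord u.1) | by [] | rewrite [(_, _).1]/=].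
have -> : 2 * (u.2./2 + 4 * (size w).-1) + (8 + odd u.2) = 4 * (2 * size w) + u.2.
  by have := odd_double_half u.2; move: r2_gt0 => /=; lia.
by rewrite modnMDl modn_small // (ltn_ord u.2).
Qed.

Lemma look_window b y : y.1 < 18 -> y.2 < 4 ->
  look w (nat_of_ord (proj r2_gt0 b y).2, nat_of_ord (proj r2_gt0 b y).1) =
  look (window w b) y.
Proof.
move=> lt18 lt4; rewrite /look row_proj //= odd_proj.
have lt9 : y.1./2 < 9 by lia.
rewrite (nth_map 0) ?size_iota // nth_iota // add0n; congr (nth _ (nth _ _ _) _).
by rewrite -divn2 (mulnC 2 (size w)) -modn_divl mulnC divnMDl // divn2.
Qed.

(** A walk no longer than the colour of its start lifts into the ball of a middle cell, where [good]
    lets this colour recur only at copies of the same vertex. *)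
Lemma colourable_of_good : packing_colourable (gH 2 (size w)) k.
Proof.
apply/existsP; exists [ffun u : gH 2 (size w) =>
  inord (look w (nat_of_ord u.2, nat_of_ord u.1))].
have colour b x : x \in cells 8 2 -> let c := look (window w b) x in
    [/\ look w (nat_of_ord (proj r2_gt0 b x).2, nat_of_ord (proj r2_gt0 b x).1) = c,
        0 < c & c <= k].
  move=> x_in; have /and3P[c_gt0 le_ck _] := allP (good_w b) x x_in.
  move: x_in; rewrite mem_cells => /and3P[_ lt10 lt4].
  by rewrite /= look_window // (leq_trans lt10).
have colourE u : exists b x, [/\ x \in cells 8 2, proj r2_gt0 b x = u,
    look w (nat_of_ord u.2, nat_of_ord u.1) = look (window w b) x,
    0 < look (window w b) x & look (window w b) x <= k].
  by have [b [x x_in <-]] := proj_surj u; have [] := colour b x x_in; exists b, x.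
apply/packing_colouringP; split=> [u | u p].
  by have [b [x [_ _ eq_c c_gt0 le_ck]]] := colourE u; rewrite ffunE eq_c inordK.
have [b [x [x_in <- eq_c c_gt0 le_ck]]] := colourE u.
have [b' [x' [_ _ eq_l _ le_l]]] := colourE (last (proj r2_gt0 b x) p).
rewrite !ffunE eq_c => xp neq_x /(congr1 val) /=.
rewrite eq_l !inordK // -eq_l => eq_last.
rewrite ltnNge; apply: contra neq_x => le_p.
have := x_in; rewrite mem_cells => /and3P[le8 _ lt4].
have le_cx : look (window w b) x <= x.1 by rewrite (leq_trans le_ck) ?(leq_trans k_le8).
have [y y_ball def_y] := path_ball le_cx lt4 le_p xp.
have [y4 _ _] := ball_path r2_gt0 b le_cx lt4 y_ball.
have /and3P[_ _ /allP/(_ y y_ball)/andP[lt18]] := allP (good_w b) x x_in.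
rewrite -look_window // def_y -eq_last eqxx => /andP[/eqP eq1 /eqP eq2].
by rewrite -def_y (proj_mod r2_gt0 b (dvdnn _) eq1 eq2).
Qed.

End UpperBound.

Definition good_word k w :=
  (0 < size w) && all (fun b => good k (2 * size w) (window w b)) (iota 0 (size w)).

Lemma colourable_of_words k ws r : k <= 8 -> all (good_word k) ws ->
  r \in [seq size w | w <- ws] -> packing_colourable (gH 2 r) k.
Proof.
move=> k_le8 /allP good_ws /mapP[w /good_ws/andP[w_gt0 /allP good_w] ->].
have r2_gt0 : 0 < 2 * size w by rewrite muln_gt0.
apply: (colourable_of_good r2_gt0) => // b.
(* Windows are periodic in [b], so finitely many checks suffice. *)
have -> : window w b = window w (b %% size w).
  by apply: eq_map => t; rewrite modnDml.
by apply: good_w; rewrite mem_iota ltn_mod.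
Qed.

(** * Explicit words for the sporadic lengths *)

Definition word2 : seq (seq nat) :=
  [::
    [:: 1; 2; 1; 3; 3; 1; 5; 1]; [:: 1; 2; 1; 6; 4; 1; 7; 1]].

Definition word4 : seq (seq nat) :=
  [::
    [:: 1; 2; 1; 3; 3; 1; 5; 1]; [:: 1; 2; 1; 4; 6; 1; 3; 1];
    [:: 1; 3; 1; 2; 2; 1; 5; 1]; [:: 1; 3; 1; 7; 4; 1; 2; 1]].

Definition word7 : seq (seq nat) :=
  [::
    [:: 1; 2; 1; 3; 3; 1; 5; 1]; [:: 1; 2; 1; 4; 6; 1; 3; 1];
    [:: 1; 3; 1; 2; 2; 1; 5; 1]; [:: 1; 7; 1; 3; 3; 1; 2; 1];
    [:: 1; 2; 1; 4; 5; 1; 3; 1]; [:: 1; 3; 1; 2; 2; 1; 7; 1];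
    [:: 1; 3; 1; 6; 4; 1; 2; 1]].

Definition word5 : seq (seq nat) :=
  [::
    [:: 1; 2; 1; 3; 3; 1; 4; 1]; [:: 1; 5; 1; 2; 2; 1; 3; 1];
    [:: 1; 4; 1; 6; 3; 1; 2; 1]; [:: 1; 5; 2; 3; 2; 1; 4; 1];
    [:: 1; 3; 1; 2; 6; 4; 5; 1]].

Definition word14 : seq (seq nat) :=
  [::
    [:: 1; 2; 1; 3; 3; 1; 4; 1]; [:: 1; 5; 1; 2; 2; 1; 3; 1];
    [:: 1; 3; 1; 6; 4; 1; 2; 1]; [:: 2; 5; 1; 3; 3; 1; 2; 1];
    [:: 1; 2; 1; 4; 6; 1; 3; 1]; [:: 1; 3; 1; 2; 2; 1; 5; 1];
    [:: 1; 4; 1; 3; 3; 1; 2; 6]; [:: 1; 5; 2; 1; 2; 1; 3; 4];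
    [:: 1; 3; 1; 2; 6; 2; 5; 1]] ++ word5.

Definition word17 : seq (seq nat) :=
  [::
    [:: 1; 2; 1; 3; 3; 1; 4; 1]; [:: 1; 5; 1; 2; 2; 1; 3; 1];
    [:: 1; 3; 1; 6; 4; 1; 2; 1]; [:: 2; 5; 1; 3; 3; 1; 2; 1];
    [:: 1; 2; 1; 4; 6; 1; 3; 1]; [:: 1; 3; 1; 2; 2; 1; 5; 1];
    [:: 1; 4; 1; 3; 3; 1; 2; 6]; [:: 1; 5; 2; 1; 2; 1; 3; 4];
    [:: 1; 3; 1; 2; 4; 2; 5; 1]; [:: 1; 6; 1; 3; 3; 1; 2; 1];
    [:: 1; 5; 2; 4; 2; 1; 3; 1]; [:: 4; 3; 1; 2; 1; 2; 5; 1];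
    [:: 6; 2; 1; 3; 3; 1; 4; 1]; [:: 1; 5; 1; 2; 2; 1; 3; 1];
    [:: 1; 4; 1; 6; 3; 1; 2; 1]; [:: 1; 5; 2; 3; 2; 1; 4; 1];
    [:: 1; 3; 1; 2; 6; 4; 5; 1]].

(** The concatenations supply the lengths 8 and 11. *)
Lemma good_words7 :
  all (good_word 7) [:: word2; word4; word7; word4 ++ word4; word4 ++ word7].
Proof. by vm_compute. Qed.

Lemma good_words6 : all (good_word 6) [:: word5; word14; word17].
Proof. by vm_compute. Qed.

(** * Colourings from two loops of blocks *)

Definition loop_blocks : seq (seq nat) :=
  [::
    [:: 1; 2; 1; 3; 3; 1; 6; 1]; [:: 1; 4; 1; 5; 2; 1; 3; 1];
    [:: 1; 3; 1; 2; 5; 1; 4; 1]; [:: 2; 6; 1; 3; 3; 1; 2; 1];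
    [:: 1; 2; 1; 5; 4; 1; 3; 1]; [:: 1; 3; 1; 2; 2; 1; 6; 1];
    [:: 1; 5; 1; 4; 3; 1; 2; 1]; [:: 1; 2; 1; 3; 4; 1; 5; 1];
    [:: 1; 6; 1; 2; 2; 1; 3; 1]; [:: 1; 3; 1; 4; 5; 1; 2; 1]].

Definition loop_block s := nth [::] loop_blocks s.

(* The block numbers form a loop of length 10 with a short cut from 2 to 0. *)
Definition next s := if s == 2 then [:: 0; 3] else if s == 9 then [:: 0] else [:: s.+1].

Definition step s t := t \in next s.

Fixpoint walks n s : seq (seq nat) :=
  if n is n'.+1 then flatten [seq [seq s :: p | p <- walks n' t] | t <- next s]
  else [:: [:: s]].

(** Goodness depends on nine consecutive blocks only, so these finitely many walks settle closed
    walks of every length. *)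
Lemma good_walks :
  all (fun s => all (fun p => good 6 0 (map loop_block p)) (walks 8 s)) (iota 0 10).
Proof. by vm_compute. Qed.

Lemma mem_walks (f : nat -> nat) m n : (forall t, step (f t) (f t.+1)) ->
  [seq f t | t <- iota m n.+1] \in walks n (f m).
Proof.
move=> step_f; elim: n m => [|n IHn] m; first exact: mem_head.
apply/flatten_mapP; exists (f m.+1); first exact: step_f.
by rewrite (map_f (cons (f m))) // IHn.
Qed.

Lemma cycle_nth (T : Type) (e : rel T) x0 s i : cycle e s -> i < size s ->
  e (nth x0 s i) (nth x0 s (i.+1 %% size s)).
Proof.
case: s => // x p /(pathP x0) e_p lt_i; have := e_p i.
rewrite size_rcons => /(_ lt_i); rewrite -rcons_cons nth_rcons /= lt_i.
rewrite nth_rcons; move: lt_i; rewrite ltnS leq_eqVlt => /predU1P[-> | lt_i].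
  by rewrite ltnn eqxx modnn.
by rewrite lt_i modn_small.
Qed.

Lemma colourable_of_cycle st : 0 < size st -> cycle step st ->
  all (fun s => s < 10) st -> packing_colourable (gH 2 (size st)) 6.
Proof.
move=> st_gt0 cyc_st lt_st; have r2_gt0 : 0 < 2 * size (map loop_block st).
  by rewrite size_map muln_gt0.
rewrite -(size_map loop_block); apply: (colourable_of_good r2_gt0) => // b.
apply: good0; pose f t := nth 0 st ((b + t) %% size st).
have -> : window (map loop_block st) b = map loop_block [seq f t | t <- iota 0 9].
  rewrite -map_comp; apply: eq_map => t /=.
  by rewrite size_map (nth_map 0) // ltn_mod.
have f0_in : f 0 \in iota 0 10.
  by rewrite mem_iota /f (allP lt_st) // mem_nth // ltn_mod.
apply: (allP (allP good_walks _ f0_in)); apply: mem_walks => t.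
have := cycle_nth 0 cyc_st (ltn_pmod (b + t) st_gt0).
by rewrite /f addnS -[(_ %% _).+1]addn1 modnDml addn1.
Qed.

(** Both loops begin at [0] and end at [9] or [2], the states that may step to [0], so they
    concatenate in any order. *)
Lemma path_loops l s : s \in [:: 2; 9] ->
  all [in [:: iota 0 10; iota 0 3]] l ->
  path step s (flatten l) && (last s (flatten l) \in [:: 2; 9]).
Proof.
elim: l s => [|u l IHl] s s_in; first by [].
rewrite /= cat_path last_cat => /andP[u_in l_in].
have /andP[-> last_u] : path step s u && (last s u \in [:: 2; 9]).
  by move: s_in u_in; rewrite !inE => /orP[]/eqP-> /orP[]/eqP->.
exact: IHl.
Qed.

Lemma colourable_loops a b : 0 < a + b ->
  packing_colourable (gH 2 (10 * a + 3 * b)) 6.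
Proof.
move=> ab_gt0; pose l := nseq a (iota 0 10) ++ nseq b (iota 0 3).
have l_in : all [in [:: iota 0 10; iota 0 3]] l.
  by rewrite all_cat !all_nseq !inE !eqxx !orbT.
have l_size : size (flatten l) = 10 * a + 3 * b.
  by rewrite size_flatten /shape map_cat sumn_cat !map_nseq !sumn_nseq.
rewrite -l_size; apply: colourable_of_cycle.
- by rewrite l_size; lia.
(* State [2] is a fictitious predecessor of the first loop; the walk closes since it begins at [0]
   and ends at [2] or [9]. *)
- have /andP[] := path_loops (isT : 2 \in [:: 2; 9]) l_in.
  case def_l: (flatten l) => [//|x p] /= /andP[x_in path_p] last_p.
  rewrite rcons_path path_p /=.
  have x0 : x = 0.
    have : size l > 0 by rewrite size_cat !size_nseq.
    case: (l) l_in def_l => // u l' /= /andP[u_in _] + _.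
    by move: u_in; rewrite !inE => /orP[]/eqP-> [].
  by move: last_p; rewrite x0 !inE => /orP[]/eqP->.
apply/allP=> s /flattenP[u /(allP l_in)].
by rewrite !inE => /orP[]/eqP->; rewrite mem_iota => /andP[_ /leq_trans->].
Qed.

Theorem theorem18 (r : nat) (hr : 2 <= r) :
  chi_rho (gH 2 r) = if r \in [:: 2; 4; 7; 8; 11] then 7 else 6.
Proof.
case: ifP => [r_bad | r_good].
  apply: chi_rho_eq; first exact: (colourable_of_words _ good_words7).
  move: r_bad; rewrite in_cons => /predU1P[-> | ]; first exact: not_colourable6_2.
  exact: not_colourable6.
apply: chi_rho_eq; last first.
  by apply: not_colourable5; move: r_good; rewrite !inE; lia.
have [r_sporadic | r_loops] := boolP (r \in [:: 5; 14; 17]).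
  exact: (colourable_of_words _ good_words6).
(* As 10 is 1 modulo 3, [r %% 3] long loops leave a multiple of 3. The remainder would be negative
   only for 4, 7 and 2, 5, 8, 11, 14, 17, all excluded by now. *)
have -> : r = 10 * (r %% 3) + 3 * ((r - 10 * (r %% 3)) %/ 3).
  by move: r_good r_loops; rewrite !inE; lia.
apply: colourable_loops.
by move: r_good r_loops; rewrite !inE; lia.
Qed.
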